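(* For every positive integer $n$ and every $(3,n)$-parking function $\pi$ with $\mathrm{pides}(\pi)=2^a1^b$, $\mathrm{area}(\pi)=\mathrm{area}(\mathbb{S}(\pi))$.
   Context: A $(3,n)$-parking function $\pi$ is a north/east lattice path from $(0,0)$ to $(3,n)$ weakly above $y=\frac n3x$ whose $n$ north steps are labeled bijectively by $1,\dots,n$ (cars, in the cells just right of the north steps), increasing upward in each column. $\mathrm{area}$ of a $(3,N)$-parking function is the number of full unit cells lying between its path and the line $y=\frac N3x$. With $d=\gcd(3,n)$, the cell with lower-left corner $(x,y)$ has rank $3y-nx+\lfloor xd/3\rfloor$. $\mathrm{ides}(\pi)=\{i:\mathrm{rank}(i)<\mathrm{rank}(i+1)\}=\{i_1<\dots<i_r\}$, $\mathrm{pides}(\pi)=(i_1,i_2-i_1,\dots,n-i_r)$; $2^a1^b$ is the composition with $a$ parts $2$ followed by $b$ parts $1$ (so $n=2a+b$). The columns are $\ell,c,r$ (left to right). For $i=1,\dots,a$ the cars $2i-1,2i$ (''pair $i$'') lie in two distinct columns, with placement type $L$ if these are $\{\ell,c\}$, $R$ if $\{c,r\}$, $C$ if $\{\ell,r\}$; the singleton car $2a+s$ ($s=1,\dots,b$) has type $L$, $C$, $R$ if it is in column $\ell$, $c$, $r$. Let $p_1,\dots,p_a$ be the pair types and $p_{a+1},\dots,p_{a+b}$ the singleton types. The switch map $\mathbb{S}$: take $b$ pairs $(2i-1,2i)$, $i\le b$, and $a$ singletons $2b+1,\dots,2b+a$, as objects $1,\dots,a+b$ (pairs first); object $j$ gets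 type $p_{a+b+1-j}$; a pair of type $L$/$R$/$C$ puts one car in each of columns $\{\ell,c\}$/$\{c,r\}$/$\{\ell,r\}$, a singleton of type $L$/$C$/$R$ goes to column $\ell$/$c$/$r$. $\mathbb{S}(\pi)$ is the resulting labeling of the $3\times(a+2b)$ grid with column heights equal to the numbers of cars assigned and cars increasing upward in each column; it is a $(3,a+2b)$-parking function. *)

(* Defs.v *)
From mathcomp Require Import all_boot all_order all_algebra.
From mathcomp Require Import zify.

Set Implicit Arguments.
Unset Strict Implicit.
Unset Printing Implicit Defensive.

(* A labelled lattice path starting at (0,0) is the word of its steps:
   [Some i] is a north step labelled by car i, [None] is an east step. *)
Definition labeled_path := seq (option nat).

(* Coordinates of the point reached after the first k steps. *)
Definition xcoord (w : labeled_path) (k : nat) : nat := count_mem None (take k w).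
Definition ycoord (w : labeled_path) (k : nat) : nat := count isSome (take k w).

Definition cars (w : labeled_path) : seq nat := pmap id w.

(* The north step labelled i starts at (col w i, row w i), which is therefore
   the lower-left corner of the cell just right of it, containing car i.
   Columns 0, 1, 2 are the columns l, c, r. *)
Definition col (w : labeled_path) (i : nat) : nat := xcoord w (index (Some i) w).
Definition row (w : labeled_path) (i : nat) : nat := ycoord w (index (Some i) w).

(* (3,n)-parking functions.  The first condition gives n north steps, the
   second 3 east steps; the third compares the lattice points of the path to the
   line y = (n/3) x, which is enough since a half-plane is convex. *)
Record is_parking_function (n : nat) (w : labeled_path) : Prop :=
  IsParkingFunction {
    cars_bij : perm_eq (cars w) (iota 1 n);
    east_steps : count_mem None w = 3;
    weakly_above : forall k, k <= size w -> n * xcoord w k <= 3 * ycoord w k;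
    increasing_columns : forall i j, i \in cars w -> j \in cars w ->
      col w i = col w j -> row w i < row w j -> i < j
  }.

Record parking_function (n : nat) : Type := ParkingFunction {
  steps :> labeled_path;
  stepsP : is_parking_function n steps
}.

(* Cell (x,y) is the unit square with lower-left corner (x,y). *)

(* It is below the path iff the east step of the path in column x has height
   at least y + 1. *)
Definition cell_below_path (w : labeled_path) (x y : nat) : bool :=
  [exists k : 'I_(size w),
    [&& nth None w k == None, xcoord w k == x & y < ycoord w k]].

(* The whole cell is above the line y = (n/3) x iff its lower-right corner is. *)
Definition cell_above_line (n x y : nat) : bool := n * x.+1 <= 3 * y.

Definition area (n : nat) (pi : parking_function n) : nat :=
  #|[set c : 'I_3 * 'I_n |
      cell_below_path pi c.1 c.2 && cell_above_line n c.1 c.2]|.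

Definition cell_rank (n x y : nat) : int :=
  ((3 * y)%:Z - (n * x)%:Z + (x * gcdn 3 n %/ 3)%:Z)%R.

Definition rank (n : nat) (pi : parking_function n) (i : nat) : int :=
  cell_rank n (col pi i) (row pi i).

Definition ides (n : nat) (pi : parking_function n) : seq nat :=
  [seq i <- iota 1 n.-1 | (rank pi i < rank pi i.+1)%R].

(* Consecutive differences of 0, i_1, ..., i_r, n. *)
Definition pides (n : nat) (pi : parking_function n) : seq nat :=
  pairmap (fun x y => y - x) 0 (rcons (ides pi) n).

Definition comp21 (a b : nat) : seq nat := nseq a 2 ++ nseq b 1.

Inductive placement : Type := L | C | R.

Definition pair_cols (t : placement) : nat * nat :=
  match t with L => (0, 1) | C => (0, 2) | R => (1, 2) end.

Definition single_col (t : placement) : nat :=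
  match t with L => 0 | C => 1 | R => 2 end.

(* Only used on two distinct columns u, v, see pair_cols_distinct. *)
Definition pair_type (u v : nat) : placement :=
  if perm_eq [:: u; v] [:: 0; 1] then L
  else if perm_eq [:: u; v] [:: 1; 2] then R
  else C.

Definition single_type (u : nat) : placement :=
  match u with 0 => L | 1 => C | _ => R end.

(* The sequence p_1, ..., p_(a+b): pairs first, then singletons. *)
Definition placements (a b : nat) (w : labeled_path) : seq placement :=
  [seq pair_type (col w (2 * i - 1)) (col w (2 * i)) | i <- iota 1 a] ++
  [seq single_type (col w (2 * a + s)) | s <- iota 1 b].

(* Column of car j when m pairs (2i-1, 2i) are followed by singletons and
   object k has type q_k (stored at position k - 1).  The type of a pair only
   determines the set of its two columns; o i = true means that the smaller car
   of pair i goes to the left one. *)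
Definition assigned_col (o : nat -> bool) (m : nat) (q : seq placement)
    (j : nat) : nat :=
  if j <= 2 * m then
    let i := uphalf j in
    let c := pair_cols (nth L q i.-1) in
    if odd j == o i then c.1 else c.2
  else single_col (nth L q (j - m).-1).

(* The path of 3 columns in which cars 1, ..., N are placed in columns
   f 1, ..., f N, increasing upward in each column. *)
Definition path_of_cols (N : nat) (f : nat -> nat) : labeled_path :=
  flatten [seq rcons [seq Some j | j <- iota 1 N & f j == x] None
          | x <- iota 0 3].

Definition switch_path (a b : nat) (o : nat -> bool) (w : labeled_path) :
    labeled_path :=
  path_of_cols (a + 2 * b) (assigned_col o b (rev (placements a b w))).

Definition path3 (A B D E : seq nat) : labeled_path :=
  map Some A ++ None :: map Some B ++ None :: map Some D ++ None :: map Some E.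

Lemma count_None_map (A : seq nat) : count_mem None (map Some A) = 0.
Proof. by elim: A. Qed.

Lemma count_isSome_map (A : seq nat) : count isSome (map Some A) = size A.
Proof. by elim: A => //= x A ->. Qed.

Lemma pmap_map_Some (A : seq nat) : pmap id (map Some A) = A.
Proof. by elim: A => //= x A ->. Qed.

Lemma cars_path3 A B D E : cars (path3 A B D E) = A ++ B ++ D ++ E.
Proof.
by rewrite /cars /path3 !(pmap_cat, pmap_map_Some) /= !(pmap_cat, pmap_map_Some)
  /= !(pmap_cat, pmap_map_Some) /= pmap_map_Some.
Qed.

Lemma split_None (w : labeled_path) m : count_mem None w = m.+1 ->
  exists A w', w = map Some A ++ None :: w' /\ count_mem None w' = m.
Proof.
elim: w => [|[i|] w IH] //=.
- rewrite add0n => /IH[A [w' [-> e]]]; by exists (i :: A), w'.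
- rewrite add1n => -[e]; by exists [::], w.
Qed.

Lemma no_None (w : labeled_path) : count_mem None w = 0 ->
  exists A, w = map Some A.
Proof.
elim: w => [|[i|] w IH] //=; first by exists [::].
by rewrite add0n => /IH[A ->]; exists (i :: A).
Qed.

Lemma split3 (w : labeled_path) : count_mem None w = 3 ->
  exists A B D E, w = path3 A B D E.
Proof.
move=> /split_None[A [w1 [-> /split_None[B [w2 [-> /split_None[D [w3 [-> /no_None[E ->]]]]]]]]]].
by exists A, B, D, E.
Qed.

Lemma take_size_catS (T : Type) (s1 : seq T) x s2 k :
  take (size s1 + k.+1) (s1 ++ x :: s2) = s1 ++ x :: take k s2.
Proof. by rewrite takeD take_size_cat // drop_size_cat. Qed.

Lemma pf_path3 n (pi : parking_function n) : exists A B D,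
  [/\ pi = path3 A B D [::] :> labeled_path, n <= 3 * size A,
      2 * n <= 3 * (size A + size B) & perm_eq (A ++ B ++ D) (iota 1 n)].
Proof.
case: pi => w /= [cw /split3[A [B [D [E def_w]]]] ab _].
move: (cw); rewrite def_w cars_path3 => cw'.
have sz : size A + (size B + (size D + size E)) = n.
  by have := perm_size cw'; rewrite !size_cat size_iota.
have szw : size w = n + 3.
  by rewrite def_w /path3; do 3!rewrite size_cat size_map /=; rewrite size_map; lia.
have h1 := ab (size A + 1); have h2 := ab (size A + (size B + 1).+1).
have h3 := ab (size A + (size B + (size D + 1).+1).+1).
have mA k : take (size A + k.+1) w = map Some A ++ None :: take k (map Some B ++ None :: map Some D ++ None :: map Some E).
  by rewrite def_w -(size_map Some A) take_size_catS.
have mB k : take (size B + k.+1) (map Some B ++ None :: map Some D ++ None :: map Some E) = map Some B ++ None :: take k (map Some D ++ None :: map Some E).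
  by rewrite -(size_map Some B) take_size_catS.
have mD k : take (size D + k.+1) (map Some D ++ None :: map Some E) = map Some D ++ None :: take k (map Some E).
  by rewrite -(size_map Some D) take_size_catS.
move: h1 h2 h3; rewrite /xcoord /ycoord !(mA, mB, mD) !take0 szw.
rewrite !(count_cat, count_None_map, count_isSome_map) /=
  !(count_cat, count_None_map, count_isSome_map) /=
  !(count_cat, count_None_map, count_isSome_map) /= => h1 h2 h3.
have E0 : E = [::] by apply: size0nil; lia.
exists A, B, D; rewrite E0 cats0 in def_w cw'.
by rewrite E0; split=> //; lia.
Qed.

Lemma mem_mapSome (A : seq nat) i : (Some i \in map Some A) = (i \in A).
Proof. by rewrite mem_map // => x y []. Qed.

Lemma index_mapSome (A : seq nat) i : index (Some i) (map Some A) = index i A.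
Proof. by rewrite index_map // => x y []. Qed.

Lemma take_index_cat (T : eqType) (x : T) s1 s2 :
  take (index x (s1 ++ s2)) (s1 ++ s2) =
  if x \in s1 then take (index x s1) s1 else s1 ++ take (index x s2) s2.
Proof.
rewrite index_cat; case: ifP => h; last by rewrite takeD take_size_cat // drop_size_cat.
by rewrite takel_cat // index_size.
Qed.

Lemma col_row_path3_aux (A B D : seq nat) (i : nat) : i \in A ++ B ++ D ->
  let w := path3 A B D [::] in
  (col w i, row w i) =
  if i \in A then (0, index i A)
  else if i \in B then (1, size A + index i B)
  else (2, size A + (size B + index i D)).
Proof.
rewrite !mem_cat /= => hi.
have ct (S : seq nat) : i \in S -> count isSome (take (index (Some i) (map Some S)) (map Some S)) = index i S.
  by move=> iS; rewrite -map_take count_isSome_map size_take index_mapSome index_mem iS.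
have cn (S : seq nat) : count_mem None (take (index (Some i) (map Some S)) (map Some S)) = 0.
  by rewrite -map_take count_None_map.
rewrite /col /row /xcoord /ycoord /path3 take_index_cat mem_mapSome.
case: ifP hi => [iA _|_ /= hi]; first by rewrite ct // cn.
rewrite take_index_cat mem_mapSome.
case: ifP hi => [iB _|_ /= iD].
  by rewrite !count_cat /= ct // cn count_None_map count_isSome_map.
rewrite take_index_cat mem_mapSome iD.
rewrite !count_cat /= !count_cat /= !count_None_map !count_isSome_map.
by rewrite ct // cn.
Qed.

Lemma col_row_path3 (A B D : seq nat) (i : nat) : i \in A ++ B ++ D ->
  let w := path3 A B D [::] in
  let v := if i \in A then (0, index i A)
           else if i \in B then (1, size A + index i B)
           else (2, size A + (size B + index i D)) in
  col w i = v.1 /\ row w i = v.2.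
Proof. by move=> /col_row_path3_aux /= <-. Qed.

Lemma weakly_above_path3 n A B D :
  size A + size B + size D = n -> n <= 3 * size A ->
  2 * n <= 3 * (size A + size B) ->
  forall k, n * xcoord (path3 A B D [::]) k <= 3 * ycoord (path3 A B D [::]) k.
Proof.
move=> sz hA hB k; rewrite /xcoord /ycoord /path3 take_cat size_map.
case: ltnP => h1; first by rewrite -map_take count_None_map; lia.
case: (k - size A) => [|k1]; first by rewrite take0 cats0 count_None_map; lia.
rewrite /= take_cat size_map !count_cat /=.
case: ltnP => h2.
  by rewrite -map_take !count_None_map !count_isSome_map; lia.
case: (k1 - size B) => [|k2].
  by rewrite take0 cats0 !count_None_map !count_isSome_map; lia.
rewrite /= take_cat size_map !count_cat /=.
case: ltnP => h3.
  by rewrite -map_take !count_None_map !count_isSome_map; lia.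
case: (k2 - size D) => [|k3].
  by rewrite take0 cats0 !count_None_map !count_isSome_map; lia.
by rewrite !count_cat /= !count_None_map !count_isSome_map; lia.
Qed.

Lemma pf_col_heights n (pi : parking_function n) :
  let h x := count (fun j => col pi j == x) (iota 1 n) in
  n <= 3 * h 0 /\ 2 * n <= 3 * (h 0 + h 1).
Proof.
have [A [B [D [-> hA hB pm]]]] := pf_path3 pi.
move=> h.
have un : uniq (A ++ B ++ D) by rewrite (perm_uniq pm) iota_uniq.
have cE j : j \in A ++ B ++ D -> col (path3 A B D [::]) j =
    if j \in A then 0 else if j \in B then 1 else 2.
  by move=> /col_row_path3[-> _]; case: ifP => _ //; case: ifP.
move: un; rewrite !cat_uniq => /and3P[uA /hasPn dA /and3P[uB /hasPn dB uD]].
have hE x : h x = (x == 0) * size A + (x == 1) * size B + (x == 2) * size D.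
  rewrite /h -(permP pm) !count_cat -addnA; congr (_ + (_ + _)).
  - rewrite -(eq_in_count (a1 := fun=> x == 0)); first by case: (x == 0); rewrite ?count_predT ?count_pred0 ?mul1n.
    by move=> j jA; rewrite cE ?mem_cat jA // eq_sym.
  - rewrite -(eq_in_count (a1 := fun=> x == 1)); first by case: (x == 1); rewrite ?count_predT ?count_pred0 ?mul1n.
    move=> j jB; have /dA/negbTE/= jA : j \in B ++ D by rewrite mem_cat jB.
    by rewrite cE; [rewrite jA jB eq_sym | rewrite !mem_cat jB orbT].
  - rewrite -(eq_in_count (a1 := fun=> x == 2)); first by case: (x == 2); rewrite ?count_predT ?count_pred0 ?mul1n.
    move=> j jD; have /dA/negbTE/= jA : j \in B ++ D by rewrite mem_cat jD orbT.
    by rewrite cE; [rewrite jA (negbTE (dB j jD)) eq_sym | rewrite !mem_cat jD !orbT].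
by rewrite !hE /=; lia.
Qed.

Lemma path_of_colsE N f :
  path_of_cols N f =
  path3 [seq j <- iota 1 N | f j == 0] [seq j <- iota 1 N | f j == 1]
        [seq j <- iota 1 N | f j == 2] [::].
Proof. by rewrite /path_of_cols /path3 /= cats0 -!cats1 -!catA. Qed.

Lemma perm_cols N f : {in iota 1 N, forall j, f j < 3} ->
  perm_eq ([seq j <- iota 1 N | f j == 0] ++ [seq j <- iota 1 N | f j == 1] ++
           [seq j <- iota 1 N | f j == 2]) (iota 1 N).
Proof.
move=> hf; apply/permP => p; rewrite !count_cat.
elim: (iota 1 N) hf => //= j s IH hf.
rewrite -IH; last by move=> i si; apply: hf; rewrite inE si orbT.
by have := hf j (mem_head _ _); case: (f j) => [|[|[|m]]] //= _; lia.
Qed.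

Lemma path_of_cols_pf N f (w := path_of_cols N f)
    (h := fun x => count (fun j => f j == x) (iota 1 N)) :
  {in iota 1 N, forall j, f j < 3} ->
  N <= 3 * h 0 -> 2 * N <= 3 * (h 0 + h 1) ->
  is_parking_function N w.
Proof.
move=> hf h0 h1; have pm := perm_cols hf; rewrite /w path_of_colsE.
set A := [seq j <- _ | _ == 0] in pm *.
set B := [seq j <- _ | _ == 1] in pm *.
set D := [seq j <- _ | _ == 2] in pm *.
split.
- by rewrite cars_path3 cats0.
- by rewrite /path3 !count_cat /= !count_cat /= !count_cat /= !count_None_map.
- move=> k _; apply: weakly_above_path3.
  + by have := perm_size pm; rewrite !size_cat size_iota addnA.
  + by rewrite /A size_filter.
  + by rewrite /A /B !size_filter.
move=> i j; rewrite cars_path3 cats0 => hi hj.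
have [-> ->] := col_row_path3 hi; have [-> ->] := col_row_path3 hj.
have so p : sorted ltn [seq j <- iota 1 N | p j].
  by apply: sorted_filter; [exact: ltn_trans | exact: iota_ltn_sorted].
have inc p x y : let S := [seq j <- iota 1 N | p j] in
    x \in S -> y \in S -> index x S < index y S -> x < y.
  by move=> S; apply: (sorted_ltn_index ltn_trans (so p)).
move: hi hj; rewrite !mem_cat.
case: ifP => [iA _|_ /=]; last case: ifP => [iB _|_ /= iD].
- case: ifP => [jA _|_ /=]; last by case: ifP.
  by move=> _; apply: inc.
- case: ifP => [//|_ /=]; case: ifP => [jB _|//] _.
  by rewrite /= ltn_add2l; apply: inc.
- case: ifP => [//|_ /=]; case: ifP => [//|_ /= jD] _.
  by rewrite /= !ltn_add2l; apply: inc.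
Qed.

Lemma comp21_pairmap a b x s :
  path leq x s -> pairmap (fun u v => v - u) x s = comp21 a b ->
  last x s = x + (2 * a + b) /\ forall i, i < a -> (x + (2 * i).+1) \notin s.
Proof.
rewrite /comp21; elim: a x s => [|a IH] x s /=.
  split=> //; elim: b x s H H0 => [|b IH] x [|y s] //=; first by lia.
  by case/andP=> xy ps [e1 /(IH _ _ ps) ->]; lia.
case: s => [//|y s] /= /andP[xy ps] [e1 e2].
have [-> ni] := IH _ _ ps e2; split; first by lia.
case=> [|i] ia; rewrite inE negb_or; apply/andP; split; try by lia.
  have /allP ge := order_path_min leq_trans ps.
  by apply/negP => /ge; lia.
suff -> : x + (2 * i.+1).+1 = y + (2 * i).+1 by apply: ni; lia.
by lia.
Qed.

Lemma pides_comp21 n (pi : parking_function n) a b :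
  pides pi = comp21 a b ->
  n = 2 * a + b /\ forall i, i < a -> ~~ (rank pi (2 * i).+1 < rank pi (2 * i).+2)%R.
Proof.
move=> e.
have ps : path leq 0 (rcons (ides pi) n).
  have -> : path leq 0 (rcons (ides pi) n) = sorted leq (0 :: rcons (ides pi) n) by [].
  rewrite /ides -cats1 /= cat_path /= andbT; apply/andP; split.
    apply: (path_filter leq_trans).
    by clear; case: n => //= n; exact: (iota_sorted 0 n.+1).
  have := mem_last 0 [seq i <- iota 1 n.-1 | (rank pi i < rank pi i.+1)%R].
  move: (last _ _) => l.
  by rewrite inE mem_filter mem_iota => /orP[/eqP -> //|/andP[_]]; lia.
have [] := comp21_pairmap ps e; rewrite last_rcons !add0n => en ni.
split=> // i ia; have := ni i ia; rewrite add0n mem_rcons inE negb_or => /andP[_].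
rewrite mem_filter mem_iota negb_and => /orP[//|]; lia.
Qed.

Lemma pair_cols_distinct n (pi : parking_function n) a b i :
  pides pi = comp21 a b -> i < a -> col pi (2 * i).+1 != col pi (2 * i).+2.
Proof.
move=> /pides_comp21[en /(_ i) rk] ia; apply/negP => /eqP ec.
have [A [B [D [def_w _ _ pm]]]] := pf_path3 pi.
have inw j : 0 < j <= n -> j \in cars pi.
  by move=> hj; rewrite (perm_mem (cars_bij (stepsP pi))) mem_iota; lia.
have i1 := inw (2 * i).+1 ltac:(lia); have i2 := inw (2 * i).+2 ltac:(lia).
have := increasing_columns (stepsP pi) i2 i1 (esym ec).
have := rk ia; rewrite /rank /cell_rank -ec => r1 r2.
have er : row pi (2 * i).+1 = row pi (2 * i).+2 by lia.
move: i1 i2 ec er; rewrite def_w cars_path3 cats0 => i1 i2.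
have [-> ->] := col_row_path3 i1; have [-> ->] := col_row_path3 i2.
have idx (S : seq nat) : (2 * i).+1 \in S -> (2 * i).+2 \in S ->
    index (2 * i).+1 S = index (2 * i).+2 S -> False.
  by move=> h1 h2 /(congr1 (nth 0 S)); rewrite !nth_index //; lia.
move: i1 i2; rewrite !mem_cat.
case: ifP => [iA _|_ /=]; last case: ifP => [iB _|_ /= iD].
- case: ifP => [jA _ _|_ /=]; last by case: ifP.
  by apply: idx.
- case: ifP => [//|_ /=]; case: ifP => [jB _|//] _ /= /addnI.
  by apply: idx.
- case: ifP => [//|_ /=]; case: ifP => [//|_ /= jD] _ /= /addnI/addnI.
  by apply: idx.
Qed.

Lemma pair_typeK u v : u != v -> u < 3 -> v < 3 ->
  perm_eq [:: (pair_cols (pair_type u v)).1; (pair_cols (pair_type u v)).2] [:: u; v].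
Proof. by move: u v => [|[|[|u]]] [|[|[|v]]]. Qed.

Lemma count_objects (f : nat -> nat) (m : nat) (p1 p2 : seq placement) (x : nat) :
  size p1 = m ->
  (forall i, i < m ->
     perm_eq [:: (pair_cols (nth L p1 i)).1; (pair_cols (nth L p1 i)).2]
             [:: f (2 * i).+1; f (2 * i).+2]) ->
  (forall s, s < size p2 -> f (2 * m + s).+1 = single_col (nth L p2 s)) ->
  count (fun j => f j == x) (iota 1 (2 * m + size p2)) =
  sumn [seq ((pair_cols t).1 == x) + ((pair_cols t).2 == x) | t <- p1] +
  count (fun t => single_col t == x) p2.
Proof.
move=> <- {m} h1 h2; rewrite iotaD count_cat; congr (_ + _).
  elim/last_ind: p1 h1 {h2} => [//|p1 t IH] h1.
  rewrite size_rcons map_rcons sumn_rcons -IH; last first.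
    move=> i ip; have := h1 i; rewrite size_rcons nth_rcons ip; apply; lia.
  have -> : 2 * (size p1).+1 = 2 * size p1 + 2 by lia.
  rewrite iotaD count_cat; congr (_ + _).
  have := h1 (size p1); rewrite size_rcons ltnSn nth_rcons ltnn eqxx.
  move=> /(_ isT)/permP/(_ (pred1 x)) /=; rewrite add1n !addn0 => ->.
  by lia.
elim/last_ind: p2 h2 {h1} => [//|p2 t IH] h2.
rewrite size_rcons -cats1 count_cat -IH; last first.
  by move=> s sp; rewrite h2 ?size_rcons ?nth_rcons ?sp //; lia.
rewrite -[(size p2).+1]addn1 iotaD count_cat /=; congr (_ + (_ + _)).
have := h2 (size p2); rewrite size_rcons ltnSn nth_rcons ltnn eqxx.
by move=> /(_ isT) <-; congr (nat_of_bool (f _ == _)); lia.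
Qed.

Lemma size_placements a b w : size (placements a b w) = a + b.
Proof. by rewrite size_cat !size_map !size_iota. Qed.

Lemma assigned_col_lt3 o m q j : assigned_col o m q j < 3.
Proof.
rewrite /assigned_col; case: ifP => _; last by case: nth.
by case: nth; case: ifP.
Qed.

Lemma pf_col_lt3 n (pi : parking_function n) j : 0 < j <= n -> col pi j < 3.
Proof.
move=> hj; have [A [B [D [-> _ _ pm]]]] := pf_path3 pi.
have jin : j \in A ++ B ++ D by rewrite (perm_mem pm) mem_iota; lia.
by have [-> _] := col_row_path3 jin; case: ifP => _ //; case: ifP.
Qed.

(* Column heights in terms of the numbers of pairs and singletons of each type. *)
Lemma pf_heights n (pi : parking_function n) a b x :
  pides pi = comp21 a b ->
  let p := placements a b pi in
  count (fun j => col pi j == x) (iota 1 n) =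
  sumn [seq ((pair_cols t).1 == x) + ((pair_cols t).2 == x) | t <- take a p] +
  count (fun t => single_col t == x) (drop a p).
Proof.
move=> e p; have [en _] := pides_comp21 e.
have sd : size (drop a p) = b by rewrite size_drop size_placements; lia.
have -> : iota 1 n = iota 1 (2 * a + size (drop a p)) by rewrite sd -en.
apply: count_objects.
- by rewrite size_takel // size_placements leq_addr.
- move=> i ia; rewrite nth_take // nth_cat size_map size_iota ia.
  rewrite (nth_map 0) ?size_iota // nth_iota //.
  have -> : 2 * (1 + i) - 1 = (2 * i).+1 by lia.
  have -> : 2 * (1 + i) = (2 * i).+2 by lia.
  by apply: pair_typeK; [apply: pair_cols_distinct e ia | apply: pf_col_lt3; lia ..].
- move=> s; rewrite sd => sb; rewrite nth_drop nth_cat size_map size_iota.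
  rewrite ltnNge leq_addr /= addKn (nth_map 0) ?size_iota // nth_iota //.
  have -> : 2 * a + (1 + s) = (2 * a + s).+1 by lia.
  have : col pi (2 * a + s).+1 < 3 by apply: pf_col_lt3; lia.
  by case: (col _ _) => [|[|[|u]]].
Qed.

Lemma switch_heights o a b (p : seq placement) x :
  size p = a + b ->
  count (fun j => assigned_col o b (rev p) j == x) (iota 1 (a + 2 * b)) =
  sumn [seq ((pair_cols t).1 == x) + ((pair_cols t).2 == x) | t <- drop a p] +
  count (fun t => single_col t == x) (take a p).
Proof.
move=> sp.
have sr : size (rev p) = a + b by rewrite size_rev.
have sd : size (drop b (rev p)) = a by rewrite size_drop sr; lia.
have -> : a + 2 * b = 2 * b + size (drop b (rev p)) by lia.
rewrite (@count_objects _ b (take b (rev p)) (drop b (rev p))).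
- rewrite take_rev drop_rev sp.
  have -> : a + b - b = a by lia.
  by rewrite count_rev map_rev sumn_rev.
- by rewrite size_takel // sr leq_addl.
- move=> i ib; rewrite nth_take // /assigned_col.
  have -> : (2 * i).+1 <= 2 * b by lia.
  have -> : (2 * i).+2 <= 2 * b by lia.
  have -> : uphalf (2 * i).+1 = i.+1 by lia.
  have -> : uphalf (2 * i).+2 = i.+1 by lia.
  have -> : odd (2 * i).+1 = true by lia.
  have -> : odd (2 * i).+2 = false by lia.
  by case: (o _) => //=; rewrite (perm_catC [:: _] [:: _]).
- move=> s; rewrite sd => sa; rewrite nth_drop /assigned_col.
  have -> : ((2 * b + s).+1 <= 2 * b) = false by lia.
  by congr (single_col (nth _ _ _)); lia.
Qed.

Lemma sum_placements (s : seq placement) :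
  let P x := sumn [seq ((pair_cols t).1 == x) + ((pair_cols t).2 == x) | t <- s] in
  let S x := count (fun t => single_col t == x) s in
  [/\ S 0 + S 1 + S 2 = size s, P 0 = S 0 + S 1, P 1 = S 0 + S 2
    & P 2 = S 1 + S 2].
Proof. by elim: s => //= t s [h1 h2 h3 h4]; case: t => /=; split; lia. Qed.

Lemma switch_pf n (pi : parking_function n) a b (o : nat -> bool) :
  pides pi = comp21 a b -> is_parking_function (a + 2 * b) (switch_path a b o pi).
Proof.
move=> e; have sp := size_placements a b pi.
have [h0 h1] := pf_col_heights pi.
have [en _] := pides_comp21 e.
move: h0 h1; rewrite !(pf_heights _ e).
have [+ + + +] := sum_placements (take a (placements a b pi)).
have [+ + + +] := sum_placements (drop a (placements a b pi)).
have -> : size (take a (placements a b pi)) = a by rewrite size_takel // sp leq_addr.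
have -> : size (drop a (placements a b pi)) = b by rewrite size_drop sp; lia.
move=> *; apply: path_of_cols_pf.
- by move=> j _; apply: assigned_col_lt3.
- by rewrite switch_heights //; lia.
- by rewrite !switch_heights //; lia.
Qed.

(* The switch map, for a given order o of the two cars inside each pair. *)
Definition switch (n : nat) (pi : parking_function n) (a b : nat)
    (o : nat -> bool) (e : pides pi = comp21 a b) : parking_function (a + 2 * b) :=
  ParkingFunction (switch_pf o e).

(* Main.v *)
Require Import Defs.
From mathcomp Require Import all_boot all_order all_algebra.
From mathcomp Require Import zify.

Set Implicit Arguments.
Unset Strict Implicit.
Unset Printing Implicit Defensive.

(** The area depends only on the heights [h0], [h1] of the first two columns: it
    equals [2 h0 + h1 - (ceil (n/3) + ceil (2n/3))].  With [PL], [PC] pairs and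
    [SL], [SC] singletons of types L, C, one has
    [2 h0 + h1 = 2 PL + PC + 2 SL + SC + a].  The switch map exchanges pairs and
    singletons, so it changes this quantity by [b - a].  With [N = a + 2b] we have
    [n + N = 3 (a + b)], so the sum of the two ceilings, which is [n] or [n + 1]
    according to whether [3] divides [n], also changes by [N - n = b - a]. *)

Lemma nth_map_Some (A : seq nat) k :
  k < size A -> (nth None (map Some A) k == None) = false.
Proof. by move=> kA; rewrite (nth_map 0). Qed.

(** The three indices are the positions of the east steps, each of which leaves the top of its
    column. *)
Lemma xcoord_ycoord_path3 (A B D : seq nat) (w := path3 A B D [::]) :
  [/\ xcoord w (size A) = 0 /\ ycoord w (size A) = size A,
      xcoord w (size A + (size B).+1) = 1 /\
      ycoord w (size A + (size B).+1) = size A + size B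
    & xcoord w (size A + (size B + (size D).+1).+1) = 2 /\
      ycoord w (size A + (size B + (size D).+1).+1) = size A + size B + size D].
Proof.
have tS (S : seq nat) s k :
    take (size S + k.+1) (map Some S ++ None :: s) = map Some S ++ None :: take k s.
  by rewrite -(size_map Some S) take_size_catS.
have t0 (S : seq nat) s : take (size S) (map Some S ++ s) = map Some S.
  by rewrite take_size_cat ?size_map.
rewrite /xcoord /ycoord /w /path3 !tS !t0.
rewrite !(count_cat, count_None_map, count_isSome_map) /=.
rewrite !(count_cat, count_None_map, count_isSome_map) /=.
by rewrite !(count_cat, count_None_map, count_isSome_map) /=; split; lia.
Qed.

Lemma east_step_path3 (A B D : seq nat) k (w := path3 A B D [::]) :
  k < size w ->
  (nth None w k == None) =
  [|| k == size A, k == size A + (size B).+1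
    | k == size A + (size B + (size D).+1).+1].
Proof.
rewrite /w /path3 !(size_cat, size_map) /= !(size_cat, size_map) /=.
rewrite !(size_cat, size_map) /= nth_cat size_map => kw.
case: ltnP => h1; first by rewrite nth_map_Some //; lia.
case e1: (k - size A) => [|k1] /=; first by rewrite eqxx; lia.
rewrite nth_cat size_map.
case: ltnP => h2; first by rewrite nth_map_Some //; lia.
case e2: (k1 - size B) => [|k2] /=; first by rewrite eqxx; lia.
rewrite nth_cat size_map.
case: ltnP => h3; first by rewrite nth_map_Some //; lia.
case e3: (k2 - size D) => [|k3] /=; first by rewrite eqxx; lia.
(* Past the last east step [nth] would return its default [None]; the bound [k < size w] excludes
   this case. *)
by lia.
Qed.

(** Each column has exactly one east step, at the height given by the number of cars in that column
    and those to its left. *)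
Lemma cell_below_path3 (A B D : seq nat) x y :
  cell_below_path (path3 A B D [::]) x y =
  [|| (x == 0) && (y < size A), (x == 1) && (y < size A + size B)
    | (x == 2) && (y < size A + size B + size D)].
Proof.
have [[xA yA] [xB yB] [xD yD]] := xcoord_ycoord_path3 A B D.
apply/existsP/idP => [[k /and3P[]]|].
  rewrite east_step_path3 // => /or3P[]/eqP->.
  - by rewrite xA yA => /eqP <- ->.
  - by rewrite xB yB => /eqP <- ->.
  - by rewrite xD yD => /eqP <- ->.
have sw : size (path3 A B D [::]) = size A + size B + size D + 3.
  by rewrite /path3 !(size_cat, size_map) /= !(size_cat, size_map) /=
    !(size_cat, size_map) /=; lia.
have witness k : k < size (path3 A B D [::]) ->
    [|| k == size A, k == size A + (size B).+1
      | k == size A + (size B + (size D).+1).+1] ->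
    xcoord (path3 A B D [::]) k = x -> y < ycoord (path3 A B D [::]) k ->
    exists k : 'I_(size (path3 A B D [::])),
      [&& nth None (path3 A B D [::]) k == None,
          xcoord (path3 A B D [::]) k == x & y < ycoord (path3 A B D [::]) k].
  move=> kw ek ex ey; exists (Ordinal kw) => /=.
  by rewrite east_step_path3 // ek ex eqxx ey.
case/or3P=> /andP[/eqP ex ey].
- by apply: (witness (size A)); rewrite ?sw ?eqxx ?xA ?yA //; lia.
- by apply: (witness (size A + (size B).+1)); rewrite ?sw ?eqxx ?orbT ?xB ?yB //; lia.
- apply: (witness (size A + (size B + (size D).+1).+1));
    by rewrite ?sw ?eqxx ?orbT ?xD ?yD //; lia.
Qed.

(** The condition [m <= 3 * y] means that [y] is at least the ceiling of [m / 3], which is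
    [(m + 2) %/ 3]. Truncated subtraction gives 0 when the range of [y] is empty. *)
Lemma sum_ltn_leq_mul3 h m k :
  \sum_(y < k) ((y < h) && (m <= 3 * y)) = minn k h - (m + 2) %/ 3.
Proof. by elim: k => [|k IH]; rewrite ?big_ord0 ?big_ord_recr /= ?IH; lia. Qed.

(** The column of a car is read off the first block that contains it; uniqueness makes the blocks
    disjoint, so this is the block being counted. *)
Lemma count_col_path3 (A B D : seq nat) x (w := path3 A B D [::]) :
  uniq (A ++ B ++ D) ->
  count (fun j => Defs.col w j == x) (A ++ B ++ D) =
  (x == 0) * size A + ((x == 1) * size B + (x == 2) * size D).
Proof.
have count_const (S : seq nat) c : (forall j, j \in S -> Defs.col w j = c) ->
    count (fun j => Defs.col w j == x) S = (x == c) * size S.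
  move=> cS; rewrite -(@eq_in_count _ (fun=> x == c)).
    by case: (x == c); rewrite ?count_predT ?count_pred0 ?mul1n.
  by move=> j /cS ->; rewrite eq_sym.
rewrite !cat_uniq => /and3P[_ /hasPn dA /and3P[_ /hasPn dB _]].
rewrite !count_cat; congr (_ + (_ + _)); apply: count_const => j jS.
- by have [-> _] := @col_row_path3 A B D j ltac:(by rewrite mem_cat jS); rewrite jS.
- have /dA/negbTE /= jA : j \in B ++ D by rewrite mem_cat jS.
  have [-> _] := @col_row_path3 A B D j ltac:(by rewrite !mem_cat jS orbT).
  by rewrite jA jS.
- have /dA/negbTE /= jA : j \in B ++ D by rewrite mem_cat jS orbT.
  have [-> _] := @col_row_path3 A B D j ltac:(by rewrite !mem_cat jS !orbT).
  by rewrite jA (negbTE (dB j jS)).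
Qed.

(** Count the cells column by column: column 0 gives [size A] minus the ceiling of [n / 3], column 1
    gives [size A + size B] minus the ceiling of [2 * n / 3]. The ceilings are moved to the left to
    avoid truncated subtraction. *)
Lemma area_heights n (pi : parking_function n) :
  area pi + ((n + 2) %/ 3 + (2 * n + 2) %/ 3) =
  2 * count (fun j => Defs.col pi j == 0) (iota 1 n) +
  count (fun j => Defs.col pi j == 1) (iota 1 n).
Proof.
have [A [B [D [def_w hA hB pm]]]] := pf_path3 pi.
have sz : size A + (size B + size D) = n.
  by have := perm_size pm; rewrite !size_cat size_iota.
have hE x : count (fun j => Defs.col pi j == x) (iota 1 n) =
    (x == 0) * size A + ((x == 1) * size B + (x == 2) * size D).
  rewrite -(permP pm) def_w count_col_path3 //.
  by rewrite (perm_uniq pm) iota_uniq.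
have -> : area pi = \sum_(x < 3) \sum_(y < n)
    (cell_below_path pi x y && cell_above_line n x y).
  rewrite /area -sum1_card pair_bigA big_mkcond /=.
  by apply: eq_bigr => c _; rewrite inE; case: ifP.
rewrite !hE !big_ord_recl big_ord0 /= def_w.
have col0 : \sum_(y < n) (cell_below_path (path3 A B D [::]) 0 y &&
    cell_above_line n 0 y) = size A - (n + 2) %/ 3.
  under eq_bigr => y _ do
    rewrite cell_below_path3 /= orbF /cell_above_line muln1.
  by rewrite sum_ltn_leq_mul3; lia.
have col1 : \sum_(y < n) (cell_below_path (path3 A B D [::]) 1 y &&
    cell_above_line n 1 y) = size A + size B - (2 * n + 2) %/ 3.
  under eq_bigr => y _ do
    rewrite cell_below_path3 /= orbF /cell_above_line mulnC.
  by rewrite sum_ltn_leq_mul3; lia.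
(* In the last column a cell above the line would need [n <= y]. *)
have col2 : \sum_(y < n) (cell_below_path (path3 A B D [::]) 2 y &&
    cell_above_line n 2 y) = 0.
  rewrite big1 // => y _; have := ltn_ord y.
  by rewrite /cell_above_line; case: leqP; rewrite ?andbF //; lia.
(* By [hA] and [hB] the path stays above the line, so both truncated subtractions are exact. *)
by rewrite /bump /= col0 col1 col2; lia.
Qed.

Theorem theorem13 (n : nat) (hn : 0 < n) (pi : parking_function n) (a b : nat)
  (hpides : pides pi = comp21 a b) (o : nat -> bool) :
  area pi = area (switch o hpides).
Proof.
have sp := size_placements a b pi.
have [en _] := pides_comp21 hpides.
have := area_heights pi; rewrite !(pf_heights _ hpides).
have := area_heights (switch o hpides).
(* Rebuilding the path from the assignment puts each car in its assigned column, as all assigned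
   columns are below 3. *)
have hsw x : count (fun j => Defs.col (switch o hpides) j == x) (iota 1 (a + 2 * b)) =
    count (fun j => assigned_col o b (rev (placements a b pi)) j == x)
      (iota 1 (a + 2 * b)).
  apply: eq_in_count => j jN /=.
  set f := assigned_col _ _ _.
  have jf : j \in [seq j <- iota 1 (a + 2 * b) | f j == 0] ++
      [seq j <- iota 1 (a + 2 * b) | f j == 1] ++
      [seq j <- iota 1 (a + 2 * b) | f j == 2].
    by rewrite (perm_mem (perm_cols _)) // => i _; apply: assigned_col_lt3.
  rewrite /switch_path path_of_colsE -/f; have [-> _] := col_row_path3 jf.
  rewrite !mem_filter jN !andbT; have : f j < 3 by apply: assigned_col_lt3.
  by case: (f j) => [|[|[|m]]].
rewrite !hsw !switch_heights //.
(* Since [single_col] is injective on types, the counts of L, C, R serve as common variables: they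
   give the heights of a block of objects read either as pairs or as singletons. *)
have [+ + + _] := sum_placements (take a (placements a b pi)).
have [+ + + _] := sum_placements (drop a (placements a b pi)).
have -> : size (take a (placements a b pi)) = a by rewrite size_takel // sp leq_addr.
have -> : size (drop a (placements a b pi)) = b by rewrite size_drop sp; lia.
by lia.
Qed.
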